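(* Let $\mathcal C\le\mathbb F_q^{n\times m}$ be a rank-metric code of dimension $k$ with associated rank function $\rho=\rho_{\mathcal C}$. For all $r\in\{0,1,\dots,k\}$, $$W^{(r)}_{\mathcal C}(x,y)=\sum_{J\in\mathcal L(E)}\begin{bmatrix}\dim\mathcal C(J)\\ r\end{bmatrix}_q y^{\dim J}g_{n-\dim J}(x,y),$$ or equivalently $$W^{(r)}_{\mathcal C}(x,y)=\sum_{U\in\mathcal L(E)}\begin{bmatrix}\rho(E)-\rho(U)\\ r\end{bmatrix}_q y^{n-\dim U}g_{\dim U}(x,y).$$
   Context: $q$ prime power, $E=\mathbb F_q^n$, $\mathcal L(E)$ its subspaces. A rank-metric code is an $\mathbb F_q$-subspace $\mathcal C\le\mathbb F_q^{n\times m}$. $\mathrm{supp}(M)$ is the column space of $M$; for a subcode $\mathcal D$, $\mathrm{Supp}(\mathcal D)=\sum_{M\in\mathcal D}\mathrm{supp}(M)$ and $\mathrm{wt}(\mathcal D)=\dim\mathrm{Supp}(\mathcal D)$. $\mathcal C(J)=\{M\in\mathcal C\mid \mathrm{supp}(M)\subseteq J\}$; $J^\perp$ is the orthogonal complement for the standard dot product; $\rho_{\mathcal C}(J)=\dim\mathcal C-\dim\mathcal C(J^\perp)$. The $r$-th higher rank-weight enumerator is $W^{(r)}_{\mathcal C}(x,y)=\sum_{\mathcal D\le\mathcal C,\ \dim\mathcal D=r}x^{n-\mathrm{wt}(\mathcal D)}y^{\mathrm{wt}(\mathcal D)}$. $g_\ell(X,Y)=\prod_{i=0}^{\ell-1}(X-q^iY)$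 (empty product $1$). Gaussian coefficient $\begin{bmatrix}a\\ b\end{bmatrix}_q=\prod_{i=0}^{b-1}\frac{q^{a-i}-1}{q^{b-i}-1}$. *)

(* Defs.v *)
From HB Require Import structures.
From mathcomp Require Import all_boot all_order all_algebra.
From mathcomp Require Import mpoly.

Set Implicit Arguments.
Unset Strict Implicit.
Unset Printing Implicit Defensive.

Import GRing.Theory.
Local Open Scope ring_scope.

(* The library makes {vspace vT} a choiceType only; over a finite field there
   are finitely many subspaces, so sums over them are ordinary big sums. *)
Import VectorInternalTheory.
HB.instance Definition _ (F : finFieldType) (vT : vectType F) :=
  [Finite of {vspace vT} by <:].

Section DotProduct.
Variables (F : fieldType) (n : nat).

Definition dotv (u v : 'cV[F]_n) : F := \sum_(i < n) u i 0 * v i 0.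

Lemma dotvC u v : dotv u v = dotv v u.
Proof. by apply: eq_bigr => i _; rewrite mulrC. Qed.

Lemma dotv_linear u : scalar (dotv u).
Proof.
move=> a v w; rewrite /dotv mulr_sumr -big_split /=.
by apply: eq_bigr => i _; rewrite !mxE mulrDr mulrCA.
Qed.

Lemma dotv_bilinear :
  bilinear_for *%R (idfun \; *%R : GRing.Scale.law F F) dotv.
Proof.
split=> u; last exact: dotv_linear.
by move=> a v w; rewrite ![dotv _ u]dotvC dotv_linear.
Qed.

HB.instance Definition _ :=
  bilinear_isBilinear.Build F 'cV[F]_n 'cV[F]_n F _ _ dotv dotv_bilinear.

Lemma dotv_hermitian u v : dotv u v = (-1) ^+ false * idfun (dotv v u).
Proof. by rewrite expr0 mul1r /= dotvC. Qed.

HB.instance Definition _ :=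
  isHermitianSesquilinear.Build F 'cV[F]_n false idfun dotv dotv_hermitian.

Definition orthc (J : {vspace 'cV[F]_n}) : {vspace 'cV[F]_n} :=
  orthov (dotv : {hermitian 'cV[F]_n for false & idfun}) J.

Lemma mem_orthc (J : {vspace 'cV[F]_n}) (u : 'cV[F]_n) :
  reflect {in J, forall v : 'cV[F]_n, \sum_(i < n) u i 0 * v i 0 = 0} (u \in orthc J).
Proof. exact: (@mem_orthovP _ _ _ _ (dotv : {hermitian _ for _ & _})). Qed.

End DotProduct.

Section RankMetricCodes.
Variables (F : finFieldType) (n m : nat).
Implicit Types (M N : 'M[F]_(n, m)) (C D : {vspace 'M[F]_(n, m)}).
Implicit Types J : {vspace 'cV[F]_n}.

Definition supp M : {vspace 'cV[F]_n} := <<[seq col j M | j : 'I_m]>>%VS.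

Lemma mem_supp M (v : 'cV[F]_n) :
  reflect (exists u : 'cV[F]_m, v = M *m u) (v \in supp M).
Proof.
apply: (iffP idP) => [|[u ->]].
  rewrite /supp span_def big_map big_enum /=.
  case/memv_sumP=> w w_in ->.
  have {}w_in (j : 'I_m) : exists a : F, w j == a *: col j M.
    by have /vlineP[a ->] := w_in j isT; exists a.
  exists (\col_j xchoose (w_in j)).
  apply/colP=> i; rewrite summxE mxE; apply: eq_bigr => j _.
  by rewrite (eqP (xchooseP (w_in j))) !mxE mulrC.
have -> : M *m u = \sum_j u j 0 *: col j M.
  by apply/colP=> i; rewrite summxE mxE; apply: eq_bigr => j _; rewrite !mxE mulrC.
apply: rpred_sum => j _; apply: rpredZ; apply: memv_span.
by apply/imageP; exists j.
Qed.

Definition Supp D : {vspace 'cV[F]_n} := (\sum_(M in D) supp M)%VS.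

Definition wt D : nat := \dim (Supp D).

(* C(J); mem_shortened shows that taking the span adds no element. *)
Definition shortened C J : {vspace 'M[F]_(n, m)} :=
  <<[seq M <- enum C | (supp M <= J)%VS]>>%VS.

Lemma mem_shortened C J M :
  (M \in shortened C J) = (M \in C) && (supp M <= J)%VS.
Proof.
apply/idP/andP=> [|[CM MJ]]; last first.
  by apply: memv_span; rewrite mem_filter MJ mem_enum.
rewrite /shortened; set s := filter _ _ => /(@coord_span _ _ _ (in_tuple s)) ->.
have inC (i : 'I_(size s)) : (s`_i \in C) && (supp s`_i <= J)%VS.
  by have := mem_nth 0 (ltn_ord i); rewrite mem_filter mem_enum andbC.
split.
  by apply: rpred_sum => i _; apply: rpredZ; case/andP: (inC i).
apply/span_subvP=> _ /imageP[j _ ->]; rewrite linear_sum /=.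
apply: rpred_sum => i _; rewrite linearZ; apply: rpredZ.
have /andP[_ /span_subvP sub] := inC i.
by apply: sub; apply/imageP; exists j.
Qed.

Definition rho C J : nat := (\dim C - \dim (shortened C (orthc J)))%N.

(* 'X_0 and 'X_1 are the indeterminates x and y.  Coefficients are taken in rat
   rather than int because Gaussian coefficients are defined as quotients. *)
Definition rank_wt_enum C (r : nat) : {mpoly rat[2]} :=
  \sum_(D : {vspace 'M[F]_(n, m)} | (D <= C)%VS && (\dim D == r))
     'X_0 ^+ (n - wt D) * 'X_1 ^+ wt D.

End RankMetricCodes.

(* For b > a the factor with i = a vanishes, so the truncation of a - i is
   harmless and the value is 0. *)
Definition gauss (q a b : nat) : rat :=
  \prod_(i < b) ((q%:R ^+ (a - i) - 1) / (q%:R ^+ (b - i) - 1)).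

Definition gpoly (R : pzRingType) (q l : nat) (X Y : R) : R :=
  \prod_(i < l) (X - q%:R ^+ i * Y).

(* Main.v *)
(** Expand each Gaussian coefficient as the number of r-dimensional subcodes D
    of C(J) and exchange the sums: D contributes for exactly those J containing
    its support S, so it suffices that the sum of y^(dim J) g_(n - dim J)(x, y)
    over all J above S is x^(n - dim S) y^(dim S).  Passing to orthogonal
    complements turns this into a sum over the subspaces of S^perp, which,
    grouped by dimension, is the q-binomial theorem
    sum_u [N, u]_q y^(N - u) g_u(x, y) = x^N; the latter follows by induction
    on N from the q-Pascal rule. *)

Require Import Defs.
From HB Require Import structures.
From mathcomp Require Import all_boot all_order all_algebra all_field.
From mathcomp Require Import mpoly ring.

Set Implicit Arguments.
Unset Strict Implicit.
Unset Printing Implicit Defensive.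

Import GRing.Theory Num.Theory.
Local Open Scope ring_scope.

(** * Gaussian coefficients and the q-binomial theorem *)

Section Gauss.
Variables (q : nat) (q_gt1 : (1 < q)%N).

Lemma gauss_den_neq0 b : \prod_(i < b) (q%:R ^+ (b - i) - 1 : rat) != 0.
Proof.
apply/prodf_neq0 => i _; rewrite subr_eq0 -natrX pnatr_eq1.
by rewrite -(expn0 q) eqn_exp2l // subn_eq0 -ltnNge.
Qed.

Lemma gaussE a b :
  gauss q a b = \prod_(i < b) (q%:R ^+ (a - i) - 1) /
                \prod_(i < b) (q%:R ^+ (b - i) - 1).
Proof. by rewrite /gauss big_split /= prodfV. Qed.

Lemma gauss0 a : gauss q a 0 = 1.
Proof. by rewrite /gauss big_ord0. Qed.

Lemma gauss_gt a b : (a < b)%N -> gauss q a b = 0.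
Proof.
by move=> ab; rewrite /gauss (bigD1 (Ordinal ab)) //= subnn expr0 subrr !mul0r.
Qed.

Lemma gauss_pascal a b :
  gauss q a.+1 b.+1 = gauss q a b + q%:R ^+ b.+1 * gauss q a b.+1.
Proof.
(* For [a < b] all three coefficients vanish; otherwise [a - b] is a true difference, as the
   exponent identity used below requires. *)
have [|ba] := ltnP a b.
  by move=> ab; rewrite !gauss_gt ?mulr0 ?addr0 // ltnW.
have nz := gauss_den_neq0 b.
have := gauss_den_neq0 b.+1; rewrite !gaussE.
have -> : \prod_(i < b.+1) (q%:R ^+ (b.+1 - i) - 1) =
    (q%:R ^+ b.+1 - 1) * \prod_(i < b) (q%:R ^+ (b - i) - 1) :> rat.
  by rewrite big_ord_recl.
have -> : \prod_(i < b.+1) (q%:R ^+ (a.+1 - i) - 1) =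
    (q%:R ^+ a.+1 - 1) * \prod_(i < b) (q%:R ^+ (a - i) - 1) :> rat.
  by rewrite big_ord_recl.
rewrite big_ord_recr /= mulf_eq0 negb_or => /andP[nz1 _].
have -> : q%:R ^+ a.+1 = q%:R ^+ (a - b) * q%:R ^+ b.+1 :> rat.
  by rewrite -exprD addnS subnK.
by field; rewrite nz nz1.
Qed.

Lemma q_binomial (A : comAlgType rat) (x y : A) N :
  \sum_(u < N.+1) gauss q N u *: (y ^+ (N - u) * gpoly q u x y) = x ^+ N.
Proof.
elim: N => [|N IHN].
  by rewrite big_ord1 gauss0 scale1r /gpoly big_ord0 mulr1 !expr0.
have step u : gpoly q u.+1 x y = (x - q%:R ^+ u * y) * gpoly q u x y.
  by rewrite /gpoly big_ord_recr /= mulrC.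
rewrite big_ord_recl gauss0 subn0 scale1r.
under eq_bigr do rewrite gauss_pascal scalerDl subSS.
rewrite big_split /= addrCA.
(* [T] is the part with the factor [q ^ u] in the q-Pascal rule. The isolated term at 0 is [T 0] and
   [T N.+1] vanishes, so this part also runs over [u <= N]. *)
pose T u : A := (q%:R ^+ u * gauss q N u) *: (y ^+ (N.+1 - u) * gpoly q u x y).
have -> : y ^+ N.+1 * gpoly q 0 x y = T 0%N.
  by rewrite /T gauss0 mulr1 scale1r subn0.
have -> : \sum_(i < N.+1) (q%:R ^+ i.+1 * gauss q N i.+1) *:
            (y ^+ (N - i) * gpoly q i.+1 x y) = \sum_(i < N.+1) T i.+1.
  by apply: eq_bigr => i _; rewrite /T subSS.
have -> : T 0%N + \sum_(i < N.+1) T i.+1 = \sum_(i < N.+1) T i.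
  have TN : T N.+1 = 0 by rewrite /T gauss_gt // mulr0 scale0r.
  transitivity (\sum_(i < N.+2) T i); first by rewrite [RHS]big_ord_recl.
  by rewrite big_ord_recr /= TN addr0.
rewrite -big_split exprS -IHN mulr_sumr /=.
apply: eq_bigr => [[u /= uN] _].
rewrite /T step -scalerAr [_ * gauss _ _ _]mulrC -[in LHS]scalerA -scalerDr.
(* The terms in [q ^ u * y] cancel, leaving a factor [x]. *)
congr (_ *: _); rewrite subSn // exprS -!natrX scaler_nat -mulr_natl.
by ring.
Qed.

End Gauss.

(** * Counting subspaces over a finite field *)

Section SubspaceCount.
Variable F : finFieldType.
Local Notation q := #|F|.

(** A free [r]-tuple in [V] extends by any vector of [V] outside its span, which leaves
    [q ^ \dim V - q ^ r] choices. *)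
Lemma card_free_tuples (vT : vectType F) (V : {vspace finvect_type vT}) (r : nat) :
  (#|[pred t : r.-tuple (finvect_type vT) | free t & (<<t>> <= V)%VS]| =
   \prod_(i < r) (q ^ \dim V - q ^ i))%N.
Proof.
elim: r => [|r IHr].
  rewrite big_ord0 (eq_card (B := pred1 [tuple])) ?card1 // => t.
  by rewrite tuple0 !inE nil_free span_nil sub0v eqxx.
pose fvT := finvect_type vT.
rewrite -sum1_card big_ord_recr -IHr /= -[X in (X * _)%N]sum1_card big_distrl /=.
pose consp (p : r.-tuple fvT * fvT) := cons_tuple p.2 p.1.
rewrite (reindex consp) /=; last first.
  exists (fun t : r.+1.-tuple _ => ([tuple of behead t], thead t)) => [[t v]|t] _ /=.
    by congr (_, _); apply: val_inj.
  by rewrite [RHS]tuple_eta; apply: val_inj.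
rewrite (eq_bigl (fun p : r.-tuple fvT * fvT => (free p.1 && (<<p.1>> <= V)%VS) &&
    ((p.2 \notin <<p.1>>%VS) && (p.2 \in V)))); last first.
  move=> [t v] /=; rewrite !inE /= free_cons span_cons subv_add -memvE.
  by rewrite andbACA andbC.
rewrite -(pair_big_dep (fun t : r.-tuple fvT => free t && (<<t>> <= V)%VS)
  (fun t v => (v \notin <<t>>%VS) && (v \in V)) (fun _ _ => 1%N)) /=.
apply: eq_bigr => t /andP[free_t tV]; rewrite mul1n sum1_card.
have dim_t : \dim <<t>> = r by have /eqP-> := free_t; rewrite size_tuple.
have -> : (q ^ \dim V - q ^ r = #|V| - #|<<t>>%VS|)%N by rewrite !card_vspace dim_t.
rewrite -(cardID <<t>>%VS V) (eq_card (_ : [predI V & <<t>>%VS] =i <<t>>%VS)).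
  by rewrite addKn.
by move=> v; rewrite !inE; apply/andb_idl/subvP.
Qed.

(** Double counting: free [r]-tuples of [V] are grouped by the subspace they span. *)
Lemma card_subspaces_free_tuples (vT : vectType F) (V : {vspace finvect_type vT}) (r : nat) :
  (#|[pred D : {vspace finvect_type vT} | (D <= V)%VS & \dim D == r]| *
     \prod_(i < r) (q ^ r - q ^ i) = \prod_(i < r) (q ^ \dim V - q ^ i))%N.
Proof.
rewrite -card_free_tuples -[RHS]sum1_card.
rewrite (partition_big (fun t : r.-tuple (finvect_type vT) => <<t>>%VS)
  [pred D : {vspace finvect_type vT} | (D <= V)%VS & \dim D == r]) /=; last first.
  by move=> t /andP[/eqP-> ->]; rewrite size_tuple eqxx.
rewrite -sum_nat_const; apply: eq_bigr => D /andP[DV /eqP dimD].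
(* A free [r]-tuple inside [D] spans [D], by dimension. *)
have := card_free_tuples D r; rewrite dimD => <-.
rewrite -sum1_card; apply: eq_bigl => t.
rewrite !inE -andbA; apply: andb_id2l => /eqP dim_t.
apply/idP/idP => [tD|/andP[_ /eqP->]]; last exact: subvv.
by rewrite (subv_trans tD DV) eqEdim tD dimD dim_t size_tuple /=.
Qed.

Lemma card_subspaces (vT : vectType F) (V : {vspace vT}) (r : nat) :
  #|[pred D : {vspace vT} | (D <= V)%VS & \dim D == r]|%:R =
  gauss q (\dim V) r.
Proof.
have q_gt1 : (1 < q)%N := finNzRing_gt1 F.
(* For [d < i] both sides are 0 by truncation, so [r > \dim V] needs no separate treatment. *)
have natE d i : (q ^ d - q ^ i)%N%:R = q%:R ^+ i * (q%:R ^+ (d - i) - 1) :> rat.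
  have [le_id|/ltnW lt_di] := leqP i d.
    by rewrite natrB ?leq_exp2l // !natrX mulrBr mulr1 -exprD subnKC.
  have -> : (d - i = 0)%N by apply/eqP.
  have -> : (q ^ d - q ^ i = 0)%N by apply/eqP; rewrite subn_eq0 leq_exp2l.
  by rewrite expr0 subrr mulr0.
have prodE d : (\prod_(i < r) (q ^ d - q ^ i))%N%:R =
    \prod_(i < r) q%:R ^+ i * \prod_(i < r) (q%:R ^+ (d - i) - 1) :> rat.
  by rewrite natr_prod -big_split; apply: eq_bigr => i _; apply: natE.
have count : (#|[pred D : {vspace vT} | (D <= V)%VS & \dim D == r]| *
    \prod_(i < r) (q ^ r - q ^ i) = \prod_(i < r) (q ^ \dim V - q ^ i))%N.
  (* [finvect_type vT] carries the finite structure; it is convertible to [vT]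
     only once [vT] is an explicit record. *)
  case: vT V => T c V; exact: (@card_subspaces_free_tuples (Vector.Pack c)).
have := congr1 (fun k => k%:R : rat) count.
rewrite natrM !prodE mulrCA => /mulfI eq_count.
rewrite gaussE -eq_count ?mulfK ?gauss_den_neq0 //.
apply/prodf_neq0 => i _; rewrite expf_neq0 // pnatr_eq0 -lt0n.
exact: ltnW.
Qed.

End SubspaceCount.

(** * Orthogonal complements: dimension and duality *)

Section OrthogonalComplement.
Variables (F : fieldType) (n : nat).
Implicit Types J U V : {vspace 'cV[F]_n}.

Lemma orthcD U V : orthc (U + V) = (orthc U :&: orthc V)%VS.
Proof.
apply/eqP; rewrite eqEsubv subv_cap -orthovD subvv /=.
by rewrite orthovD -subv_cap subvv.
Qed.

Lemma orthcf : orthc fullv = 0%VS :> {vspace 'cV[F]_n}.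
Proof.
apply/eqP; rewrite -subv0; apply/subvP => u /mem_orthc u0; rewrite memv0.
(* Pairing with a standard basis vector reads off a coordinate. *)
apply/eqP/colP => i; have := u0 (delta_mx i 0) (memvf _).
rewrite (bigD1 i) //= !mxE !eqxx mulr1 big1 ?addr0 // => j ji.
by rewrite mxE (negPf ji) mulr0.
Qed.

Lemma dimcV : \dim {: 'cV[F]_n} = n.
Proof. by rewrite dimvf /dim /= muln1. Qed.

(** Each further vector lowers the dimension of the complement by at most one. *)
Lemma leq_dim_orthc_span (s : seq 'cV[F]_n) :
  (n <= size s + \dim (orthc <<s>>))%N.
Proof.
elim: s => [|v s IHs]; first by rewrite span_nil /orthc orthov0 dimcV.
rewrite span_cons orthcD capvC addSn; apply: leq_trans IHs _.
rewrite -addnS leq_add2l; apply: leq_trans (leqSpred _) _; rewrite ltnS.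
exact: leq_dim_orthov1.
Qed.

Lemma leq_dim_orthc J : (n <= \dim J + \dim (orthc J))%N.
Proof.
have := leq_dim_orthc_span (vbasis J).
by rewrite size_tuple (span_basis (vbasisP J)).
Qed.

(** [J] may meet [orthc J], so the upper bound uses a linear complement [J^C] instead: [orthc J] and
    [orthc J^C] meet in 0, and the latter has dimension at least [\dim J]. *)
Lemma dim_orthc J : \dim (orthc J) = (n - \dim J)%N.
Proof.
apply/eqP; rewrite eqn_leq leq_subLR leq_dim_orthc andbT.
have cap0 : (orthc J :&: orthc J^C = 0)%VS.
  by rewrite -orthcD addv_complf orthcf.
have := dimvS (subvf (orthc J + orthc J^C)).
have := dimv_sum_cap (orthc J) (orthc J^C); rewrite cap0 dimv0 addn0 => ->.
rewrite dimcV => le_n.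
have := leq_dim_orthc J^C; rewrite dimv_compl dimcV => leC.
have leJ : (\dim J <= n)%N by rewrite -[leqRHS]dimcV dimvS ?subvf.
have leJC : (\dim J <= \dim (orthc J^C))%N.
  by rewrite -(leq_add2l (n - \dim J)) subnK.
by rewrite -(leq_add2r (\dim J)) subnK // (leq_trans _ le_n) // leq_add2l.
Qed.

Lemma orthcK : involutive (@orthc F n).
Proof.
move=> J; apply/esym/eqP; rewrite eqEdim {1}/orthc orthov_sym subvv /=.
by rewrite !dim_orthc subKn // -[leqRHS]dimcV dimvS ?subvf.
Qed.

Lemma orthcS U V : (orthc U <= orthc V)%VS = (V <= U)%VS.
Proof. by rewrite {2}/orthc orthov_sym -/(orthc _) orthcK. Qed.

End OrthogonalComplement.

(** * Shortened codes and the enumerator *)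

Section Shortening.
Variables (F : finFieldType) (n m : nat).
Implicit Types (C D : {vspace 'M[F]_(n, m)}) (J S : {vspace 'cV[F]_n}).

Lemma sub_shortened C J D :
  (D <= shortened C J)%VS = (D <= C)%VS && (Supp D <= J)%VS.
Proof.
apply/subvP/andP => [DCJ|[/subvP DC /subv_sumP DJ] M MD].
  split; first by apply/subvP => M /DCJ; rewrite mem_shortened => /andP[].
  by apply/subv_sumP => M /DCJ; rewrite mem_shortened => /andP[].
by rewrite mem_shortened DC //= DJ.
Qed.

Lemma shortened0 C : shortened C 0 = 0%VS.
Proof.
apply/eqP; rewrite -subv0; apply/subvP => M.
rewrite mem_shortened memv0 => /andP[_ M0]; apply/eqP/matrixP => i j.
have /(subvP M0): M *m delta_mx j 0 \in supp M.
  by apply/mem_supp; exists (delta_mx j 0).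
by rewrite memv0 -colE => /eqP/colP/(_ i); rewrite !mxE.
Qed.

Lemma rho_sub C J : (rho C fullv - rho C J = \dim (shortened C (orthc J)))%N.
Proof.
rewrite /rho orthcf shortened0 dimv0 subn0 subKn // dimvS //.
by apply/subvP => M; rewrite mem_shortened => /andP[].
Qed.

Lemma sum_superspaces (A : comAlgType rat) (x y : A) S :
  \sum_(J : {vspace 'cV[F]_n} | (S <= J)%VS)
     y ^+ \dim J * gpoly #|F| (n - \dim J) x y = x ^+ (n - \dim S) * y ^+ \dim S.
Proof.
have leJ J : (\dim J <= n)%N by rewrite -[leqRHS](dimcV F) dimvS ?subvf.
rewrite (reindex_inj (inv_inj (@orthcK F n))) /=.
set N := (n - \dim S)%N.
under eq_big => [U|U _].
  rewrite -{1}(orthcK S) orthcS; over.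
  rewrite dim_orthc subKn //; over.
have leN U : (U <= orthc S)%VS -> (\dim U < N.+1)%N.
  by move=> /dimvS; rewrite dim_orthc.
(* Group by dimension; by [leN], [inord] never takes its default value. *)
rewrite (partition_big (fun U => inord (\dim U) : 'I_N.+1) predT) //=.
rewrite -(@q_binomial #|F| (finNzRing_gt1 F) _ x y N) mulr_suml.
apply: eq_bigr => u _; rewrite -scalerAl.
have -> : gauss #|F| N u =
    #|[pred U : {vspace 'cV[F]_n} | (U <= orthc S)%VS & \dim U == u]|%:R.
  by rewrite card_subspaces dim_orthc.
rewrite scaler_nat -sumr_const.
rewrite (eq_bigl (fun U => (U <= orthc S)%VS && (\dim U == u))); last first.
  move=> U; apply: andb_id2l => US; apply/eqP/eqP => [<-|Uu].
    by rewrite inordK // leN.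
  by apply: val_inj; rewrite /= inordK // leN.
apply: eq_bigr => U /andP[_ /eqP->].
rewrite mulrAC -exprD addnC; congr (_ ^+ _ * _).
have uN : (u <= N)%N by rewrite -ltnS.
by rewrite /N addnBA // subnKC // leJ.
Qed.

Lemma rank_wt_enum_shortened C r :
  rank_wt_enum C r =
    \sum_(J : {vspace 'cV[F]_n})
       gauss #|F| (\dim (shortened C J)) r
         *: ('X_1 ^+ \dim J * gpoly #|F| (n - \dim J) 'X_0 'X_1).
Proof.
rewrite /rank_wt_enum; under eq_bigr do rewrite -sum_superspaces.
(* After the exchange, the term of [J] occurs once for each [r]-dimensional [D] in
   [shortened C J]. *)
rewrite (exchange_big_dep predT) //=; apply: eq_bigr => J _.
rewrite -card_subspaces scaler_nat -sumr_const; apply: eq_bigl => D.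
by rewrite inE sub_shortened -!andbA; congr (_ && _); rewrite andbC.
Qed.

End Shortening.

Theorem theorem4p5 (F : finFieldType) (n m k : nat)
    (C : {vspace 'M[F]_(n, m)}) (dimC : \dim C = k) (r : nat) (ler : (r <= k)%N) :
  let q := #|F| in
  let x : {mpoly rat[2]} := 'X_0 in
  let y : {mpoly rat[2]} := 'X_1 in
  rank_wt_enum C r =
    \sum_(J : {vspace 'cV[F]_n})
       gauss q (\dim (shortened C J)) r *: (y ^+ \dim J * gpoly q (n - \dim J) x y)
  /\
  rank_wt_enum C r =
    \sum_(U : {vspace 'cV[F]_n})
       gauss q (rho C fullv - rho C U) r
         *: (y ^+ (n - \dim U) * gpoly q (\dim U) x y).
Proof.
split; rewrite rank_wt_enum_shortened //.
(* The second formula is the first one at [J = orthc U]. *)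
rewrite (reindex_inj (inv_inj (@orthcK F n))) /=; apply: eq_bigr => U _.
by rewrite rho_sub dim_orthc subKn // -[leqRHS](dimcV F) dimvS ?subvf.
Qed.
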